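(* There is a net in $\mathcal{M}$ which is simultaneously a right cc-approximate unit and a left rc-approximate unit for $\mathcal{M}$. Thus the same net is also a two-sided pc-approximate unit for $\mathcal{M}$.
   Context: $\mathfrak{X}$ is a fixed compact metrizable space and $\mathfrak{m}$ is a fixed Borel probability measure on $\mathfrak{X}$ whose support is all of $\mathfrak{X}$. $\mathcal{M}=\mathcal{M}_{\mathfrak{X},\mathfrak{m}}$ denotes the Banach $*$-algebra $\mathbf{C}(\mathfrak{X}^2)$ of continuous complex functions on $\mathfrak{X}\times\mathfrak{X}$ with the supremum norm, the multiplication $(f\star g)(x,y)=\int_{\mathfrak{X}}f(x,z)g(z,y)\,d\mathfrak{m}(z)$ and the involution $f^*(x,y)=\overline{f(y,x)}$. Topologies on $\mathcal{M}$: the pointwise convergence topology (pct) is the vector topology in which $f_\lambda\to f$ iff $f_\lambda(x,y)\to f(x,y)$ for all $x,y\in\mathfrak{X}$; the column-wise convergence topology (cct) is the vector topology in which $f_\lambda\to f$ iff $\sup_{x}|f_\lambda(x,y)-f(x,y)|\to0$ for every $y\in\mathfrak{X}$; the row-wise convergence topology (rct) is the vector topology in which $f_\lambda\to f$ iff $\sup_{y}|f_\lambda(x,y)-f(x,y)|\to0$ for every $x\in\mathfrak{X}$. A right norm- (resp. pc-, cc-, rc-) approximate unit for $\mathcal{M}$ is a net $(u_\lambda)_\lambda$ in $\mathcal{M}$ such that $a\star u_\lambda\to a$ in the norm topology (resp. pct, cct, rct) for every $a\in\mathcal{M}$; a left one is defined in the same way with $u_\lambda\star a\to a$; a two-sided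 one is both left and right. *)

(* Defs.v *)
From HB Require Import structures.
From mathcomp Require Import all_boot all_order all_algebra.
From mathcomp Require Import complex lra.
From mathcomp Require Import all_classical all_reals all_analysis.
From mathcomp Require Import measurable_realfun.

Set Implicit Arguments.
Unset Strict Implicit.
Unset Printing Implicit Defensive.

Import Order.TTheory GRing.Theory Num.Theory numFieldNormedType.Exports.
Import ComplexField.Normc.

Local Open Scope classical_set_scope.
Local Open Scope ring_scope.
Local Open Scope complex_scope.

(* The complex numbers, declared as a [numClosedFieldType] so that they carry
   the topology given by the modulus. *)
Definition cplx (R : realType) : numClosedFieldType := R[i].

Section complex_continuity.
Context (R : realType).

Lemma continuous_Re : continuous (@complex.Re R : cplx R -> R).
Proof.
move=> z; apply: (@cvgrPdist_lt _ _ _ (nbhs z) _ _ _).2 => e e0.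
have e0' : 0 < (e%:C : cplx R) by rewrite ltcR.
near=> t.
have : ball z (e%:C : cplx R) t by near: t; exact: nbhsx_ballx.
rewrite -ball_normE/=.
rewrite -raddfB -ltcR; apply: le_lt_trans; exact: normc_ge_Re.
Unshelve. all: by end_near. Qed.

Lemma continuous_Im : continuous (@complex.Im R : cplx R -> R).
Proof.
move=> z; apply: (@cvgrPdist_lt _ _ _ (nbhs z) _ _ _).2 => e e0.
have e0' : 0 < (e%:C : cplx R) by rewrite ltcR.
near=> t.
have : ball z (e%:C : cplx R) t by near: t; exact: nbhsx_ballx.
rewrite -ball_normE/=.
rewrite -raddfB -ltcR; apply: le_lt_trans.
rewrite normc_def lecR -sqrtr_sqr ler_wsqrtr// lerDr sqr_ge0//.
Unshelve. all: by end_near. Qed.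

Lemma continuous_complex (Y : topologicalType) (a b : Y -> R) :
  continuous a -> continuous b ->
  continuous ((fun y => a y +i* b y) : Y -> cplx R).
Proof.
have cC : continuous ((fun r : R => r%:C) : R -> cplx R).
  move=> r; apply: (@cvgrPdist_lt _ (cplx R) _ (nbhs r) _ _ _).2 => e.
  rewrite ltcE/= => /andP[/eqP ie re].
  have -> : e = (complex.Re e)%:C by case: e ie {re} => ? ? /= ->.
  near=> t; rewrite -rmorphB/= normc_def/= expr0n/= addr0 sqrtr_sqr ltcR.
  suff: ball r (complex.Re e) t by rewrite -ball_normE.
  by near: t; exact: nbhsx_ballx.
have cCc (c : Y -> R) : continuous c -> continuous ((fun y => (c y)%:C) : Y -> cplx R).
  by move=> cc y; apply: (@continuous_comp _ _ _ c _ y (cc y) (cC (c y))).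
move=> ca cb y.
rewrite (_ : (fun _ => _) = (fun y => (a y)%:C : cplx R) \+
    (fun y => (('i : R[i]) : cplx R) * ((b y)%:C : cplx R)));
  last by apply/funext => z /=; simpc.
apply: (@continuousD (cplx R) (cplx R)); first exact: cCc.
apply: (@continuousM (cplx R)); first exact: cst_continuous.
exact: cCc.
Unshelve. all: by end_near. Qed.

End complex_continuity.

Section spaces.
Context (R : realType) (X : ptopologicalType).

Definition metrizable : Prop :=
  exists d : X -> X -> R,
    [/\ forall x y, d x y = 0 <-> x = y,
        forall x y, d x y = d y x,
        forall x y z, d x z <= d x y + d y z &
        forall x, nbhs x =
          filter_from [set e : R | 0 < e] (fun e => [set y | d x y < e])].

Definition borel : measurableType (sigma_display (@open X)) :=
  g_sigma_algebraType (@open X).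

Definition measure_support (m : probability borel R) : set X :=
  [set x | forall U : set X, open U -> U x -> (0 < m U)%E].

Lemma continuous_borel_measurable (f : X -> R) :
  continuous f -> measurable_fun setT (f : borel -> R).
Proof.
move=> /continuousP cf; apply: (measurability _ (RGenOpens.measurableE R)).
move=> _ [_ [a [b ->] <-]]; rewrite setTI; apply: sub_sigma_algebra.
exact/cf/interval_open.
Qed.

Lemma continuous_borel_integrable (m : probability borel R) (f : X -> R) :
  compact [set: X] -> continuous f -> m.-integrable setT (EFin \o f).
Proof.
move=> cX cf; apply: measurable_bounded_integrable => //.
- by rewrite (le_lt_trans (probability_le1 _ _)) ?ltry.
- exact: continuous_borel_measurable.
- have := compact_bounded (continuous_compact (continuous_subspaceT cf) cX).
  by move=> [M [? h]]; exists M; split=> // x Mx y _; apply: (h x Mx); exists y.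
Qed.

Lemma continuous_parametric_Rintegral (m : probability borel R)
    (Y : topologicalType) (H : Y * X -> R) :
  compact [set: X] -> continuous H ->
  continuous (fun y => \int[m]_z H (y, z)).
Proof.
move=> cX cH.
have cHy y : continuous (fun z => H (y, z)).
  move=> z; apply: (@continuous_comp _ _ _ (fun z => (y, z)) H); last exact: cH.
  by apply: cvg_pair; [exact: cvg_cst|exact: cvg_id].
have iH y : m.-integrable setT (EFin \o (fun z => H (y, z))).
  exact: continuous_borel_integrable.
move=> y; apply: (@cvgrPdist_le _ _ _ (nbhs y) _ _ _).2 => e e0.
have : \forall q \near y, [set: X] `<=` (fun z => `|H (y, z) - H (q, z)| <= e).
  apply: ((compact_near_coveringP _).1 cX) => z _.
  have e20 : 0 < e / 2 by rewrite divr_gt0.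
  have Hz : \forall p \near (y, z), `|H (y, z) - H p| < e / 2.
    by apply: (@cvgr_dist_lt _ _ _ (nbhs (y, z)) _ H) => //; exact: cH.
  have Hz' : \forall z' \near z, `|H (y, z) - H (y, z')| < e / 2.
    by apply: (@cvgr_dist_lt _ _ _ (nbhs z) _ (fun z => H (y, z))) => //; exact: cHy.
  case: Hz => -[A B] /= [Ay Bz] AB.
  exists ([set z' | `|H (y, z) - H (y, z')| < e / 2] `&` B, A).
    by split => //; exact: filterI.
  move=> [z' q] /= [[h1 Bz'] Aq]; have h2 := AB (q, z') (conj Aq Bz').
  by rewrite /= in h2; move: h1 h2; rewrite !ltr_norml ler_norml; lra.
apply: filterS => q hq.
have cD : continuous (fun z => H (y, z) - H (q, z)).
  by move=> z; apply: (@continuousB R R^o _ _ (H \o pair q)); exact: cHy.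
rewrite -RintegralB//.
apply: le_trans; first apply: le_normr_Rintegral => //.
  exact: continuous_borel_integrable.
have <- : \int[m]_(z in setT) e = e.
  rewrite Rintegral_cst//; transitivity (e * 1); last exact: mulr1.
  by congr (_ * _); exact: (congr1 fine (probability_setT m)).
apply: le_Rintegral => //.
- apply: (@continuous_borel_integrable _ (fun z => `|H (y, z) - H (q, z)|)) => //.
  move=> z; apply: (@continuous_comp _ _ _ _ (@Num.norm _ R^o) z (cD z)).
  exact: norm_continuous.
- apply: (@continuous_borel_integrable _ (fun=> e)) => //.
  exact: cst_continuous.
Qed.

(* The library only integrates real-valued functions. *)
Definition Cintegral (m : probability borel R) (h : X -> cplx R) : cplx R :=
  (\int[m]_z complex.Re (h z)) +i* (\int[m]_z complex.Im (h z)).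

Definition kernels := continuousType (X * X)%type (cplx R).

Definition kernel_mul_fun (m : probability borel R) (f g : X * X -> cplx R) :
    X * X -> cplx R :=
  fun p => Cintegral m (fun z => f (p.1, z) * g (z, p.2)).

Lemma kernel_mul_fun_continuous (m : probability borel R) (f g : kernels) :
  compact [set: X] -> continuous (kernel_mul_fun m f g).
Proof.
move=> cX.
pose H (q : (X * X) * X) : cplx R := f (q.1.1, q.2) * g (q.2, q.1.2).
have cH : continuous H.
  move=> q; apply: (@continuousM (cplx R) _ (fun q : (X * X) * X => f (q.1.1, q.2))
                        (fun q => g (q.2, q.1.2))).
  - apply: (@continuous_comp _ _ _ (fun q : (X * X) * X => (q.1.1, q.2)) f);
      last exact: cts_fun.
    apply: cvg_pair; last exact: cvg_snd.
    by apply: (@continuous_comp _ _ _ (@fst (X * X)%type X) fst); exact: cvg_fst.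
  - apply: (@continuous_comp _ _ _ (fun q : (X * X) * X => (q.2, q.1.2)) g);
      last exact: cts_fun.
    apply: cvg_pair; first exact: cvg_snd.
    apply: (@continuous_comp _ _ _ (@fst (X * X)%type X) snd); first exact: cvg_fst.
    exact: cvg_snd.
have cRe : continuous ((@complex.Re R : cplx R -> R) \o H).
  by move=> q; apply: (@continuous_comp _ _ _ H); [exact: cH|exact: continuous_Re].
have cIm : continuous ((@complex.Im R : cplx R -> R) \o H).
  by move=> q; apply: (@continuous_comp _ _ _ H); [exact: cH|exact: continuous_Im].
exact: (continuous_complex (continuous_parametric_Rintegral (m := m) cX cRe)
                           (continuous_parametric_Rintegral (m := m) cX cIm)).
Qed.

(* Compactness of [X] is what makes the product continuous again. *)
Definition kernel_mul (m : probability borel R) (cX : compact [set: X])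
    (f g : kernels) : kernels :=
  HB.pack (kernel_mul_fun m f g)
    (isContinuous.Build _ _ _
      (kernel_mul_fun_continuous (m := m) (f := f) (g := g) cX)).

Lemma kernel_mulE m cX f g x y :
  kernel_mul m cX f g (x, y) = Cintegral m (fun z => f (x, z) * g (z, y)).
Proof. by []. Qed.

(* Column [y] is the set of all [(x, y)], so that uniform convergence on
   columns is uniformity in the first variable for each fixed second one;
   see [pct_cvgP], [cct_cvgP] and [rct_cvgP] below. *)
Definition columns : set (set (X * X)) := [set setT `*` [set y] | y in setT].
Definition rows : set (set (X * X)) := [set [set x] `*` setT | x in setT].

Definition pct : topologicalType :=
  initial_topology (fun f : kernels => (f : {ptws X * X -> cplx R})).
Definition cct : topologicalType :=
  initial_topology (fun f : kernels => (f : {family columns, X * X -> cplx R})).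
Definition rct : topologicalType :=
  initial_topology (fun f : kernels => (f : {family rows, X * X -> cplx R})).

End spaces.

Lemma initial_cvgP (S : choiceType) (T : topologicalType) (j : S -> T)
    (F : set_system S) (s : S) : Filter F ->
  (F --> (s : initial_topology j)) <-> (j @ F --> j s).
Proof.
move=> FF; split=> [Fs|Fjs A].
  move=> A jsA; apply: (Fs (j @^-1` A)).
  exact: (@initial_continuous S T j s A jsA).
rewrite nbhsE => -[_ [[B oB <-] Bjs] BA].
by apply: filterS BA _; apply: Fjs; apply: open_nbhs_nbhs.
Qed.

Section topologies.
Context (R : realType) (X : ptopologicalType) (cX : compact [set: X]).
Implicit Types (f g : kernels R X) (F : set_system (kernels R X)).

Lemma cplx_dist_ltE (z w : cplx R) (e : R) :
  (`|z - w| < (e%:C : cplx R)) = (normc (w - z) < e).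
Proof. by rewrite distrC -[`|_|]/((normc (w - z))%:C) ltcR. Qed.

Lemma has_sup_dist f g (A : set (X * X)) : A !=set0 ->
  has_sup [set normc (g p - f p) | p in A].
Proof.
move=> [a Aa]; split; first by exists (normc (g a - f a)), a.
have cn : continuous ((fun p => normc (g p - f p)) : X * X -> R).
  move=> p.
  apply: (@continuous_comp _ _ _ (fun q => `|(g q : cplx R) - f q|)
    (@complex.Re R : cplx R -> R)); last exact: continuous_Re.
  apply: (@continuous_comp _ _ _ (fun q => (g q : cplx R) - f q)); last first.
    exact: (@norm_continuous _ (cplx R)).
  by apply: (@continuousB (cplx R) (cplx R)); exact: cts_fun.
have cXX : compact [set: X * X] by rewrite -setXTT; exact: compact_setX.
have [M [_ hM]] :=
  compact_bounded (continuous_compact (continuous_subspaceT cn) cXX).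
exists (M + 1) => _ [p _ <-].
apply: le_trans (ler_norm _) _; apply: (hM (M + 1)); first by rewrite ltrDl.
by exists p.
Qed.

Lemma uniform_cvg_supP (A : set (X * X)) F f : Filter F -> A !=set0 ->
  {uniform A, (fun g : kernels R X => (g : X * X -> cplx R)) @ F --> (f : X * X -> cplx R)}
  <-> (fun g : kernels R X => sup [set normc (g p - f p) | p in A]) @ F -->
      (0 : R).
Proof.
move=> FF A0; split.
  move=> Ff; apply: (@cvgrPdist_le _ _ _ F _ _ _).2 => e e0.
  have e0' : 0 < (e%:C : cplx R) by rewrite ltcR.
  have : nbhs (f : {uniform` A -> cplx R})
    [set h | forall p, A p -> ball (f p) (e%:C : cplx R) (h p)].
    apply/uniform_nbhs; exists [set xy | ball xy.1 (e%:C : cplx R) xy.2].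
    by split => //; rewrite -entourage_ballE; exists (e%:C : cplx R).
  move=> /Ff FE.
  have {FE} : \forall g \near F,
      forall p, A p -> ball (f p) (e%:C : cplx R) ((g : kernels R X) p) by exact: FE.
  apply: filterS => g hg.
  have [_ hb] := has_sup_dist f g A0; have [a Aa] := A0.
  rewrite sub0r normrN ger0_norm.
    apply: ge_sup; first by exists (normc (g a - f a)), a.
    move=> _ [p Ap <-]; apply/ltW; rewrite -cplx_dist_ltE.
    by have := hg p Ap; rewrite -ball_normE.
  apply: le_trans (ub_le_sup hb _); last by exists a => //.
  exact: (@normr_ge0 _ (Rcomplex R)).
move=> Fs P /uniform_nbhs[E [+ EP]]; rewrite -entourage_ballE => -[e /= e0 eE].
suff : \forall g \near F, forall p, A p -> E (f p, (g : kernels R X) p).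
  by move=> FE; apply: (@filterS _ F FF _ _ _ FE) => g gE; exact: EP.
move: e0; rewrite ltcE /= => /andP[/eqP ie re].
have eC : e = (complex.Re e)%:C by case: e ie {re eE} => ? ? /= ->.
have Fe := @cvgr_dist_lt _ _ _ F FF _ _ Fs _ re.
apply: (@filterS _ F FF _ _ _ Fe) => g; rewrite sub0r normrN => /(le_lt_trans (ler_norm _)) hg p Ap.
apply: eE => /=; rewrite -ball_normE /= eC cplx_dist_ltE.
apply: le_lt_trans hg; apply: ub_le_sup; last by exists p.
by have [] := has_sup_dist f g A0.
Qed.

Lemma pct_cvgP F f : Filter F ->
  F --> (f : pct R X) <->
  forall x y, (fun g : kernels R X => g (x, y)) @ F --> f (x, y).
Proof.
move=> FF; apply: (iff_trans (initial_cvgP _ _ FF)).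
apply: (iff_trans (pointwise_cvgP _ _)).
by split=> [h x y|h [x y]]; exact: h.
Qed.

Lemma cct_cvgP F f : Filter F ->
  F --> (f : cct R X) <->
  forall y, (fun g : kernels R X =>
      sup [set normc (g (x, y) - f (x, y)) | x in setT]) @ F --> (0 : R).
Proof.
move=> FF; apply: (iff_trans (initial_cvgP _ _ FF)).
apply: (iff_trans (fam_cvgP _ _ _)).
have E y (g : kernels R X) : [set normc (g (x, y) - f (x, y)) | x in setT] =
    [set normc (g p - f p) | p in setT `*` [set y]].
  apply/seteqP; split=> [_ [x _ <-]|_ [[x y'] /= [_ ->] <-]].
    by exists (x, y).
  by exists x.
split=> [h y|h _ [y _ <-]].
  under eq_fun do rewrite E.
  apply/uniform_cvg_supP; first by exists (point, y).
  by apply: h; exists y.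
apply/uniform_cvg_supP; first by exists (point, y).
by have := h y; under eq_fun do rewrite E.
Qed.

Lemma rct_cvgP F f : Filter F ->
  F --> (f : rct R X) <->
  forall x, (fun g : kernels R X =>
      sup [set normc (g (x, y) - f (x, y)) | y in setT]) @ F --> (0 : R).
Proof.
move=> FF; apply: (iff_trans (initial_cvgP _ _ FF)).
apply: (iff_trans (fam_cvgP _ _ _)).
have E x (g : kernels R X) : [set normc (g (x, y) - f (x, y)) | y in setT] =
    [set normc (g p - f p) | p in [set x] `*` setT].
  apply/seteqP; split=> [_ [y _ <-]|_ [[x' y] /= [-> _] <-]].
    by exists (x, y).
  by exists y.
split=> [h x|h _ [x _ <-]].
  under eq_fun do rewrite E.
  apply/uniform_cvg_supP; first by exists (x, point).
  by apply: h; exists x.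
apply/uniform_cvg_supP; first by exists (x, point).
by have := h x; under eq_fun do rewrite E.
Qed.

End topologies.

Record net (T : Type) := Net {
  net_index : Type;
  net_le : net_index -> net_index -> Prop;
  net_nonempty : inhabited net_index;
  net_le_refl : forall i, net_le i i;
  net_le_trans : forall i j k, net_le i j -> net_le j k -> net_le i k;
  net_directed : forall i j, exists k, net_le i k /\ net_le j k;
  net_val :> net_index -> T }.

Definition net_tails (T : Type) (u : net T) : set_system (net_index u) :=
  filter_from setT (fun i => [set j | net_le i j]).

Arguments net_tails : clear implicits.
Arguments net_tails {T} u.

#[global] Instance net_tails_filter (T : Type) (u : net T) : ProperFilter (net_tails u).
Proof.
have [i0] := net_nonempty u.
apply: filter_from_proper; last by move=> i _; exists i; exact: net_le_refl.
apply: filter_from_filter; first by exists i0.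
move=> i j _ _; have [k [ik jk]] := net_directed i j.
by exists k => // l kl; split; apply: net_le_trans kl.
Qed.

Section approximate_units.
Context (R : realType) (X : ptopologicalType).
Context (m : probability (borel X) R) (cX : compact [set: X]).
Implicit Types (u : net (kernels R X)).
Local Notation "f ⋆ g" := (kernel_mul m cX f g) (at level 40, left associativity).

Definition right_cc_approximate_unit u : Prop :=
  forall a : kernels R X, (a ⋆ u l) @[l --> net_tails u] --> (a : cct R X).

Definition left_rc_approximate_unit u : Prop :=
  forall a : kernels R X, (u l ⋆ a) @[l --> net_tails u] --> (a : rct R X).

Definition right_pc_approximate_unit u : Prop :=
  forall a : kernels R X, (a ⋆ u l) @[l --> net_tails u] --> (a : pct R X).

Definition left_pc_approximate_unit u : Prop :=
  forall a : kernels R X, (u l ⋆ a) @[l --> net_tails u] --> (a : pct R X).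

Definition two_sided_pc_approximate_unit u : Prop :=
  left_pc_approximate_unit u /\ right_pc_approximate_unit u.

End approximate_units.

(* Main.v *)
(* For a point p let b_p be the tent function of radius r at p and I_p its
   integral, which is positive because m has full support.  For a finite set S
   of points that are pairwise at distance at least r, the symmetric kernel
     u(x, y) = sum over p in S of b_p(x) b_p(y) / (r I_p)
   satisfies u(-, p) = u(p, -) = b_p / I_p for every p in S, since b_q(p) = 0 for
   the other q in S and b_p(p) = r.  Along the net of the pairs (S, r), the
   column and the row of u at any given point thus become probability densities
   concentrating at that point, and integrating a continuous kernel against them
   converges uniformly in the remaining variable because X is compact. *)

Require Import Defs.
From HB Require Import structures.
From mathcomp Require Import all_boot all_order all_algebra.
From mathcomp Require Import complex lra.
From mathcomp Require Import all_classical all_reals all_analysis.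

Set Implicit Arguments.
Unset Strict Implicit.
Unset Printing Implicit Defensive.

Import Order.TTheory GRing.Theory Num.Theory numFieldNormedType.Exports.
Import ComplexField.Normc.

Local Open Scope classical_set_scope.
Local Open Scope ring_scope.
Local Open Scope complex_scope.

(** * Comparison of the complex modulus with real and imaginary parts *)

Section complex_modulus.
Context (R : realType).

Lemma normr_Re_le_normc (z : R[i]) : `|complex.Re z| <= normc z.
Proof.
by case: z => a b /=; rewrite -sqrtr_sqr ler_wsqrtr// lerDl sqr_ge0.
Qed.

Lemma normr_Im_le_normc (z : R[i]) : `|complex.Im z| <= normc z.
Proof.
by case: z => a b /=; rewrite -sqrtr_sqr ler_wsqrtr// lerDr sqr_ge0.
Qed.

(** Both sides are nonnegative, so it suffices to compare squares; these differ by the cross term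
    [2 |a| |b|]. *)
Lemma normc_le_normrD (z : R[i]) :
  normc z <= `|complex.Re z| + `|complex.Im z|.
Proof.
case: z => a b /=.
rewrite -[leRHS]ger0_norm ?addr_ge0// -[leRHS]sqrtr_sqr ler_wsqrtr//.
rewrite -(real_normK (num_real a)) -(real_normK (num_real b)) sqrrD.
by rewrite addrAC lerDl mulrn_wge0// mulr_ge0.
Qed.

End complex_modulus.

(** * Averages against a continuous probability density *)

Section weighted_averages.
Context (R : realType) (X : ptopologicalType).
Context (m : probability (borel X) R) (cX : compact [set: X]).

(** The bounds [(c - e) w <= f w <= (c + e) w] hold everywhere, trivially where [w] vanishes.
    Integrating them against total mass 1 leaves [c - e] and [c + e]. *)
Lemma Rintegral_average_dist (f w : X -> R) (c e : R) :
  continuous f -> continuous w -> (forall z, 0 <= w z) ->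
  \int[m]_z w z = 1 -> (forall z, w z != 0 -> `|f z - c| <= e) ->
  `|\int[m]_z (f z * w z) - c| <= e.
Proof.
move=> cf cw w0 w1 fc.
have iw : m.-integrable setT (EFin \o w) by exact: continuous_borel_integrable.
have cfw : continuous (fun z => f z * w z).
  by move=> z; apply: (@continuousM R); [exact: cf|exact: cw].
have ccw r : continuous (fun z => r * w z).
  by move=> z; apply: (@continuousM R); [exact: cst_continuous|exact: cw].
have ifw := continuous_borel_integrable m cX cfw.
have icw r := continuous_borel_integrable m cX (ccw r).
have ir r : \int[m]_z (r * w z) = r by rewrite RintegralZl// w1 mulr1.
have fcw z : (c - e) * w z <= f z * w z <= (c + e) * w z.
  have [->|/fc] := eqVneq (w z) 0; first by rewrite !mulr0 lexx.
  by rewrite ler_distl => /andP[? ?]; rewrite !ler_wpM2r.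
rewrite ler_distl -[X in X <= _ <= _]ir -[X in _ <= _ <= X]ir.
by apply/andP; split; apply: le_Rintegral => // z _; have /andP[] := fcw z.
Qed.

(** Real and imaginary parts are averaged separately and each contributes an error [e]. *)
Lemma Cintegral_average_dist (f : X -> cplx R) (w : X -> R) (c : cplx R) (e : R) :
  continuous f -> continuous w -> (forall z, 0 <= w z) ->
  \int[m]_z w z = 1 -> (forall z, w z != 0 -> normc (f z - c) <= e) ->
  normc (Cintegral m (fun z => f z * (w z)%:C) - c) <= e + e.
Proof.
move=> cf cw w0 w1 fc.
apply: le_trans (normc_le_normrD _) _; rewrite !raddfB /=.
have -> : (fun z => complex.Re (f z * (w z)%:C)) = (fun z => complex.Re (f z) * w z).
  by apply/funext => z; case: (f z) => a b /=; rewrite mulr0 subr0.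
have -> : (fun z => complex.Im (f z * (w z)%:C)) = (fun z => complex.Im (f z) * w z).
  by apply/funext => z; case: (f z) => a b /=; rewrite mulr0 add0r.
apply: lerD; apply: Rintegral_average_dist => //.
- by move=> z; apply: (@continuous_comp _ _ _ f _ z (cf z)); exact: continuous_Re.
- move=> z /fc; apply: le_trans; rewrite -raddfB; exact: normr_Re_le_normc.
- by move=> z; apply: (@continuous_comp _ _ _ f _ z (cf z)); exact: continuous_Im.
- move=> z /fc; apply: le_trans; rewrite -raddfB; exact: normr_Im_le_normc.
Qed.

End weighted_averages.

(** A tube-lemma argument: [h] is continuous and vanishes at every [(x, y)], so it is small on a
    product neighbourhood of each such point, and compactness yields one neighbourhood of [y] valid
    for all [x]. *)
Lemma near_forall_normc_le (R : realType) (X : topologicalType)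
    (g : X * X -> cplx R) (y : X) (e : R) :
  compact [set: X] -> continuous g -> 0 < e ->
  \forall z \near y, forall x, normc (g (x, z) - g (x, y)) <= e.
Proof.
move=> cX cg e0.
pose h (p : X * X) : R := normc (g p - g (p.1, y)).
have ch : continuous h.
  (* The real-valued modulus is the real part of the complex-valued norm. *)
  move=> p; apply: (@continuous_comp _ _ _ (fun p => `|(g p : cplx R) - g (p.1, y)|)
    (@complex.Re R : cplx R -> R)); last exact: continuous_Re.
  apply: (@continuous_comp _ _ _ (fun p => (g p : cplx R) - g (p.1, y))); last first.
    exact: (@norm_continuous _ (cplx R)).
  apply: (@continuousB (cplx R) (cplx R)); first exact: cg.
  apply: (@continuous_comp _ _ _ (fun p : X * X => (p.1, y)) g); last exact: cg.
  by apply: cvg_pair; [exact: cvg_fst|exact: cvg_cst].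
have : \forall z \near y, [set: X] `<=` (fun x => h (x, z) <= e).
  apply: ((compact_near_coveringP _).1 cX) => x _.
  have [[A B] /= [Ax By] AB] : \forall p \near (x, y), h p < e.
    apply: (@cvgr_lt _ _ _ _ _ _ (ch (x, y))).
    by rewrite /h subrr normc0.
  by exists (A, B) => // -[x' z] [/= Ax' Bz]; apply/ltW/(AB (x', z)).
by apply: filterS => z hz x; exact: (hz x).
Qed.

(** * Tent functions of a compatible metric *)

Section bumps.
Context (R : realType) (X : ptopologicalType) (d : X -> X -> R).
Context (d_eq0 : forall x y, d x y = 0 <-> x = y).
Context (d_sym : forall x y, d x y = d y x).
Context (d_triangle : forall x y z, d x z <= d x y + d y z).
Context (nbhs_d : forall x, nbhs x =
  filter_from [set e : R | 0 < e] (fun e => [set y | d x y < e])).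

Lemma dist_refl x : d x x = 0. Proof. exact/d_eq0. Qed.

Lemma dist_ge0 x y : 0 <= d x y.
Proof. by have := d_triangle x y x; rewrite dist_refl (d_sym y); lra. Qed.

Lemma dist_continuous p : continuous (d ^~ p).
Proof.
move=> x; apply: (@cvgrPdist_lt _ _ _ (nbhs x) _ _ _).2 => e e0.
change (nbhs x [set y | `|d x p - d y p| < e]); rewrite nbhs_d.
exists e => //= y /= xy.
rewrite ltr_norml; have := d_triangle x y p; have := d_triangle y x p.
by rewrite (d_sym y x); lra.
Qed.

Definition bump (r : R) (p x : X) : R := Num.max 0 (r - d x p).

Lemma bump_ge0 r p x : 0 <= bump r p x.
Proof. by rewrite le_max lexx. Qed.

Lemma bump_eq0 r p x : r <= d x p -> bump r p x = 0.
Proof. by move=> rd; apply/max_l; rewrite subr_le0. Qed.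

Lemma bump_center r p : 0 <= r -> bump r p p = r.
Proof. by move=> r0; rewrite /bump dist_refl subr0; exact/max_r. Qed.

Lemma bump_continuous r p : continuous (bump r p).
Proof.
move=> x; apply: (@continuous_max R X (fun=> 0) (fun x => r - d x p)).
  exact: cst_continuous.
by apply: (@continuousB R R^o); [exact: cst_continuous|exact: dist_continuous].
Qed.

(** * Normalised tents and the symmetric kernel built from them *)

Context (m : probability (borel X) R) (cX : compact [set: X]).
Context (suppm : measure_support m = [set: X]).

(** On the open ball [B] of radius [r / 2] the tent is at least [r / 2], and [B] has positive mass
    by full support; hence the integral is at least [(r / 2) m(B) > 0]. *)
Lemma Rintegral_bump_gt0 r p : 0 < r -> 0 < \int[m]_x bump r p x.
Proof.
move=> r0; have r20 : 0 < r / 2 by rewrite divr_gt0.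
pose B : set (borel X) := [set x | d x p < r / 2].
have oB : @open X B.
  have /continuousP cd := @dist_continuous p.
  by apply: (cd [set t | t < r / 2]); exact: open_lt.
have mB : measurable B by exact: sub_sigma_algebra.
have Bp : B p by rewrite /B /= dist_refl.
have mB0 : (0 < m B)%E.
  have : measure_support m p by rewrite suppm.
  by apply.
have ib := continuous_borel_integrable m cX (@bump_continuous r p).
have [mb _] := integrableP _ _ _ ib.
(* The real integral is the [fine] part of the extended one, so finiteness is needed along with
   positivity. *)
apply: fine_gt0; apply/andP; split; last first.
  by rewrite ltey_eq (integrable_fin_num _ ib).
apply: (@lt_le_trans _ _ ((r / 2)%:E * m B)%E).
  by rewrite mule_gt0 ?lte_fin.
rewrite -integral_cst//.
apply: (@le_trans _ _ (\int[m]_(x in B) (bump r p x)%:E)%E).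
  apply: ge0_le_integral => //=.
  - by move=> *; rewrite lee_fin ltW.
  - exact: (measurable_funS measurableT (@subsetT _ B) mb).
  - move=> x Bx; rewrite lee_fin /bump le_max; apply/orP; right.
    by move: Bx; rewrite /B /=; lra.
apply: ge0_subset_integral => //.
- by move=> *; rewrite lee_fin bump_ge0.
Qed.

Definition unit_bump r p x := bump r p x / \int[m]_z bump r p z.

Definition peak_fun (s : seq X) (r : R) (q : X * X) : R :=
  \sum_(p <- s) bump r p q.1 * unit_bump r p q.2 / r.

(** The normalising integral depends on [p] alone and can be moved to either factor. Thanks to this
    symmetry, statements on columns also serve for rows. *)
Lemma peak_fun_sym s r x y : peak_fun s r (x, y) = peak_fun s r (y, x).
Proof.
by apply: eq_bigr => p _; rewrite /unit_bump /= !mulrA (mulrC (bump r p x)).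
Qed.

(** After the swap, [y] sits in the unnormalised tent. A tent of radius [r] already vanishes at
    distance [r], so only the term of [y] survives, once by [uniq s]; its height [r] cancels the
    division by [r]. *)
Lemma peak_fun_column s r y x : 0 < r -> uniq s ->
  {in s &, forall p q, p != q -> r <= d p q} -> y \in s ->
  peak_fun s r (x, y) = unit_bump r y x.
Proof.
move=> r0 us sep ys; rewrite peak_fun_sym /peak_fun (bigD1_seq y)//=.
rewrite bump_center ?ltW// big1_seq ?addr0; last first.
  by move=> p /andP[py ps]; rewrite bump_eq0 ?mul0r// sep// eq_sym.
by rewrite mulrAC divff ?mul1r// gt_eqF.
Qed.

Lemma dist_gt0 x y : x != y -> 0 < d x y.
Proof.
by move=> xy; rewrite lt_def dist_ge0 andbT; apply: contra xy => /eqP/d_eq0 ->.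
Qed.

Lemma unit_bump_ge0 r p x : 0 < r -> 0 <= unit_bump r p x.
Proof.
by move=> r0; rewrite divr_ge0 ?bump_ge0// ltW// Rintegral_bump_gt0.
Qed.

Lemma unit_bump_continuous r p : continuous (unit_bump r p).
Proof.
move=> x; apply: (@continuousM R); first exact: bump_continuous.
exact: cst_continuous.
Qed.

Lemma Rintegral_unit_bump r p : 0 < r -> \int[m]_x unit_bump r p x = 1.
Proof.
move=> r0; rewrite RintegralZr//; last first.
  exact: (continuous_borel_integrable m cX (@bump_continuous r p)).
by rewrite divff// gt_eqF// Rintegral_bump_gt0.
Qed.

Lemma peak_fun_continuous s r : continuous (peak_fun s r).
Proof.
have cF p : continuous (fun q : X * X => bump r p q.1 * unit_bump r p q.2 / r).
  move=> q.
  apply: (@continuousM R _ (fun q : X * X => bump r p q.1 * unit_bump r p q.2));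
    last exact: cst_continuous.
  apply: (@continuousM R _ (fun q : X * X => bump r p q.1)
    (fun q => unit_bump r p q.2)).
    apply: (@continuous_comp _ _ _ fst (bump r p)); first exact: cvg_fst.
    exact: bump_continuous.
  apply: (@continuous_comp _ _ _ snd (unit_bump r p)); first exact: cvg_snd.
  exact: unit_bump_continuous.
by apply: (@continuous_big R X +%R 0 xpredT) => //; exact: (@add_continuous R).
Qed.

Definition peak_kernel (s : seq X) (r : R) : kernels R X :=
  HB.pack (fun q => (peak_fun s r q)%:C : cplx R)
    (isContinuous.Build _ _ _
      (continuous_complex (@peak_fun_continuous s r)
        (fun q : X * X => @cst_continuous _ _ (0 : R) q))).

(** * The directed index set of separated finite sets *)

Definition separated (i : seq X * R) : Prop :=
  [/\ uniq i.1, 0 < i.2 & {in i.1 &, forall p q, p != q -> i.2 <= d p q}].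

(** The radius is the minimum of [e] and the finitely many positive distances between points of
    [s]. *)
Lemma separated_exists (s : seq X) (e : R) : uniq s -> 0 < e ->
  exists2 r, r <= e & separated (s, r).
Proof.
move=> us e0.
have [r [r0 re rl]] : exists r, [/\ 0 < r, r <= e &
    forall t, t \in [seq d p q | p <- s, q <- s] -> 0 < t -> r <= t].
  (* Induction on the list of distances; an entry that is not positive, such as [d p p], leaves [r]
     unchanged. *)
  elim: [seq _ | _ <- _, _ <- _] => [|t l [r [r0 re rl]]]; first by exists e.
  have [t0|t0] := ltP 0 t; last first.
    exists r; split=> // t'; rewrite inE => /orP[/eqP ->|]; last exact: rl.
    by rewrite ltNge t0.
  exists (Num.min t r); split; first by rewrite lt_min t0.
    by rewrite ge_min re orbT.
  move=> t'; rewrite inE ge_min => /orP[/eqP -> _|tl t'0].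
    by rewrite lexx.
  by rewrite rl// orbT.
exists r => //; split=> // p q ps qs pq; apply: rl; last exact: dist_gt0.
exact: (allpairs_f d).
Qed.

Definition finer (i j : {i | separated i}) : Prop :=
  {subset (sval i).1 <= (sval j).1} /\ (sval j).2 <= (sval i).2.

Lemma finer_refl i : finer i i.
Proof. by split. Qed.

Lemma finer_trans i j k : finer i j -> finer j k -> finer i k.
Proof.
move=> [ij ji] [jk kj]; split; last exact: le_trans ji.
by move=> x /ij /jk.
Qed.

Lemma finer_directed i j : exists k, finer i k /\ finer j k.
Proof.
have [_ i0 _] := svalP i; have [_ j0 _] := svalP j.
have e0 : 0 < Num.min (sval i).2 (sval j).2 by rewrite lt_min i0.
(* The common refinement is the union of the two point sets, with a radius below both given ones and
   small enough to separate the union. *)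
have [r re sr] := separated_exists (undup_uniq ((sval i).1 ++ (sval j).1)) e0.
move: re; rewrite le_min => /andP[ri rj].
exists (exist _ _ sr); split; split=> //= x xs;
  by rewrite mem_undup mem_cat xs ?orbT.
Qed.

(** Separation of a single point is vacuous, so every positive radius is allowed. Such indices show
    that the index type is inhabited and serve as thresholds in the net. *)
Lemma separated_seq1 y r : 0 < r -> separated ([:: y], r).
Proof. by split=> //= p q; rewrite !inE => /eqP -> /eqP ->; rewrite eqxx. Qed.

Definition peak_net : net (kernels R X) :=
  Net (inhabits (exist _ _ (separated_seq1 point ltr01)))
    finer_refl finer_trans finer_directed
    (fun i => peak_kernel (sval i).1 (sval i).2).

(** Far enough along the net, the column at [y] is a probability density supported where [g (x, z)]
    is close to [g (x, y)] uniformly in [x]. Taking [g] to be any continuous function covers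
    transposed kernels too. *)
Lemma peak_net_average (g : X * X -> cplx R) (y : X) (e : R) :
  continuous g -> 0 < e ->
  \forall l \near net_tails peak_net, forall x,
    normc (Cintegral m (fun z => g (x, z) * peak_net l (z, y)) - g (x, y)) <= e.
Proof.
(* Half of [e] is reserved for each of the real and imaginary parts. *)
move=> cg e0; have e20 : 0 < e / 2 by rewrite divr_gt0.
have := near_forall_normc_le y cX cg e20.
rewrite /prop_near1 nbhs_d => -[r /= r0 hr].
(* Any index [(s, t)] beyond [([:: y], r)] satisfies [y \in s] and [t <= r]. *)
exists (exist _ _ (separated_seq1 y r0)) => //= -[[s t] [us t0 sep]].
move=> [/= ys tr] x.
have yins : y \in s by apply: ys; rewrite inE.
have -> : (fun z => g (x, z) * (peak_fun s t (z, y))%:C) =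
    (fun z => g (x, z) * (unit_bump t y z)%:C).
  by apply/funext => z; rewrite peak_fun_column.
rewrite (splitr e).
apply: (@Cintegral_average_dist _ _ _ cX (fun z => g (x, z))).
- move=> z; apply: (@continuous_comp _ _ _ (fun z => (x, z)) g); last exact: cg.
  by apply: cvg_pair; [exact: cvg_cst|exact: cvg_id].
- exact: unit_bump_continuous.
- by move=> z; exact: unit_bump_ge0.
- exact: Rintegral_unit_bump.
(* Where the density is nonzero, [z] lies within [t <= r] of [y]. *)
- move=> z zn0; apply: hr => /=; rewrite d_sym; apply: lt_le_trans tr.
  by rewrite ltNge; apply: contra zn0 => ?; rewrite /unit_bump bump_eq0 ?mul0r.
Qed.

End bumps.

(** * Epsilon criteria for convergence in the three topologies *)

Section convergence_criteria.
Context (R : realType) (X : ptopologicalType) (cX : compact [set: X]).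
Implicit Types (f g : kernels R X) (F : set_system (kernels R X)).

Lemma normr_sup_le (A : set R) (e : R) : A !=set0 ->
  (forall t, A t -> 0 <= t <= e) -> `|sup A| <= e.
Proof.
move=> [a Aa] Ae; have /andP[a0 _] := Ae a Aa.
have ubA : ubound A e by move=> t /Ae /andP[].
rewrite ger0_norm; first by apply: ge_sup => //; exists a.
by apply: (le_trans a0); apply: ub_le_sup => //; exists e.
Qed.

Lemma cct_cvg F f : Filter F ->
  (forall y e, 0 < e ->
    \forall g \near F, forall x, normc ((g : kernels R X) (x, y) - f (x, y)) <= e) ->
  F --> (f : cct R X).
Proof.
move=> FF Ff; apply/(cct_cvgP cX) => y.
apply: (@cvgrPdist_le _ _ _ F _ _ _).2 => e e0.
apply: filterS (Ff y e e0) => g ge; rewrite sub0r normrN.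
apply: normr_sup_le => [|_ [x _ <-]].
  by exists (normc (g (point, y) - f (point, y))), point.
by rewrite ge andbT; exact: (@normr_ge0 _ (Rcomplex R)).
Qed.

Lemma rct_cvg F f : Filter F ->
  (forall x e, 0 < e ->
    \forall g \near F, forall y, normc ((g : kernels R X) (x, y) - f (x, y)) <= e) ->
  F --> (f : rct R X).
Proof.
move=> FF Ff; apply/(rct_cvgP cX) => x.
apply: (@cvgrPdist_le _ _ _ F _ _ _).2 => e e0.
apply: filterS (Ff x e e0) => g ge; rewrite sub0r normrN.
apply: normr_sup_le => [|_ [y _ <-]].
  by exists (normc (g (x, point) - f (x, point))), point.
by rewrite ge andbT; exact: (@normr_ge0 _ (Rcomplex R)).
Qed.

Lemma pct_cvg F f : Filter F ->
  (forall x y e, 0 < e ->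
    \forall g \near F, normc ((g : kernels R X) (x, y) - f (x, y)) <= e) ->
  F --> (f : pct R X).
Proof.
move=> FF Ff; apply/pct_cvgP => x y.
apply: (@cvgrPdist_lt _ (cplx R) _ F _ _ _).2 => e.
(* A positive element of [cplx R] has zero imaginary part, so [e] is replaced by its real part; half
   of it turns the weak bound into a strict one. *)
rewrite ltcE/= => /andP[/eqP ie re].
have -> : e = (complex.Re e)%:C by case: e ie {re} => ? ? /= ->.
have e20 : 0 < complex.Re e / 2 by rewrite divr_gt0.
apply: filterS (Ff x y _ e20) => g ge; rewrite cplx_dist_ltE.
by apply: (le_lt_trans ge); lra.
Qed.

End convergence_criteria.

Theorem theorem3p1 (R : realType) (X : ptopologicalType)
    (cX : compact [set: X]) (metX : metrizable R X)
    (m : probability (borel X) R) (suppm : measure_support m = [set: X]) :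
  exists u : net (kernels R X),
    [/\ right_cc_approximate_unit m cX u,
        left_rc_approximate_unit m cX u &
        two_sided_pc_approximate_unit m cX u].
Proof.
have [d [d_eq0 d_sym d_tri nbhs_d]] := metX.
pose u := peak_net d_eq0 d_sym d_tri nbhs_d m.
have right_avg (a : kernels R X) y e : 0 < e ->
    \forall l \near net_tails u, forall x,
      normc (kernel_mul m cX a (u l) (x, y) - a (x, y)) <= e.
  by move=> e0; apply: peak_net_average => //; exact: cts_fun.
have left_avg (a : kernels R X) x e : 0 < e ->
    \forall l \near net_tails u, forall y,
      normc (kernel_mul m cX (u l) a (x, y) - a (x, y)) <= e.
  move=> e0.
  (* By symmetry of the peak kernel, the integral of [u(x, z) a(z, y)] over [z] is an average of the
     transpose of [a] against the column at [x], so the averaging lemma applies to that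
     transpose. *)
  have cg : continuous (fun p => a (p.2, p.1)).
    move=> p; apply: (@continuous_comp _ _ _ (fun p : X * X => (p.2, p.1)) a).
      by apply: cvg_pair; [exact: cvg_snd|exact: cvg_fst].
    exact: cts_fun.
  have := peak_net_average d_eq0 d_sym d_tri nbhs_d cX suppm x cg e0.
  apply: filterS => l ul y; rewrite kernel_mulE; apply: le_trans (ul y).
  rewrite le_eqVlt; apply/orP; left; apply/eqP; congr (normc (Cintegral m _ - _)).
  by apply/funext => z; rewrite mulrC /= peak_fun_sym.
exists u; split=> [a|a|]; [| |split=> a].
- by apply: cct_cvg => // y e; exact: right_avg.
- by apply: rct_cvg => // x e; exact: left_avg.
(* Pointwise convergence on either side follows by fixing the remaining variable in the uniform
   estimate. *)
- apply: pct_cvg => // x y e e0.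
  by apply: filterS (left_avg a x e e0) => l; exact.
- apply: pct_cvg => // x y e e0.
  by apply: filterS (right_avg a y e e0) => l; exact.
Qed.
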